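(* Let $n\ge 1$ and let $R_n(w)=\sum_{m=0}^{n}A_m w^m$ be a right quaternionic polynomial with coefficients $A_m\in\mathbb{H}$, $A_n\neq 0$, and suppose $A_0\neq 0$. Let $\{w_1,\dots,w_n\}$ be a set of roots of $R_n$, taken with multiplicity. Then $$\sum_{m=1}^{n}\frac{\mathrm{Sc}(w_m)}{|w_m|^2}=-\frac{(A_1,A_0)}{|A_0|^2}.$$
   Context: $\mathbb{H}=\{x_0+x_1i+x_2j+x_3k : x_0,\dots,x_3\in\mathbb{R}\}$ is the skew field of real quaternions, $i^2=j^2=k^2=-1$, $ij=-ji=k$, $jk=-kj=i$, $ki=-ik=j$. For $w=x_0+x_1i+x_2j+x_3k$ put $\mathrm{Sc}(w)=x_0$, $\mathrm{Vec}(w)=x_1i+x_2j+x_3k$, $\overline{w}=x_0-x_1i-x_2j-x_3k$, $|w|=\sqrt{x_0^2+x_1^2+x_2^2+x_3^2}$. The scalar product of $w$ and $v=y_0+y_1i+y_2j+y_3k$ is $(w,v)=\sum_{m=0}^{3}x_my_m$. Basic polynomial of $R_n$: the polynomial of a complex variable $$F^*_{2n}(z)=\sum_{m=0}^{2n}\Big(\sum_{d+r=m,\ 0\le d,r\le n}\overline{A}_dA_r\Big)z^m.$$ Its coefficients are real and its degree is $2n$. A root of $R_n$ is $w\in\mathbb{H}$ with $\sum_{m=0}^n A_mw^m=0$. A root $w$ with $|\mathrm{Vec}(w)|=r>0$ is spherical if every quaternion $w'$ with $\mathrm{Sc}(w')=\mathrm{Sc}(w)$ and $|\mathrm{Vec}(w')|=r$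 is also a root; the whole sphere of such $w'$ is then counted as one spherical root. The other roots are isolated. Multiplicity: the multiplicity of an isolated or spherical root $w$ of $R_n$ is the multiplicity, as a root of $F^*_{2n}$, of the complex number $z$ (equivalently $\overline{z}$) with $\mathrm{Re}\,z=\mathrm{Sc}(w)$, $|\mathrm{Im}\,z|=|\mathrm{Vec}(w)|$; if $z$ is real, the multiplicity of $w$ is half the multiplicity of $z$. Set of roots: a list $\{w_1,\dots,w_n\}$ containing each isolated root as many times as its multiplicity and, for each spherical root of multiplicity $k$, containing $k$ arbitrary quaternions chosen from that sphere. With multiplicity, the total number of roots is exactly $n$. *)

(* Defs.v *)
From HB Require Import structures.
From mathcomp Require Import all_boot all_order all_algebra.
From mathcomp Require Import reals complex ring.

Set Implicit Arguments.
Unset Strict Implicit.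
Unset Printing Implicit Defensive.

Import Order.TTheory GRing.Theory Num.Theory.
Local Open Scope ring_scope.

(** Quat a b c d stands for a + b i + c j + d k. *)
Record quat (R : Type) := Quat { q0 : R; q1 : R; q2 : R; q3 : R }.

Section QuatRing.
Variable R : realType.
Implicit Types p q r : quat R.

Definition quat_tuple q := (q0 q, q1 q, q2 q, q3 q).
Definition tuple_quat (t : R * R * R * R) :=
  let: (a, b, c, d) := t in Quat a b c d.
Lemma quat_tupleK : cancel quat_tuple tuple_quat. Proof. by case. Qed.

HB.instance Definition _ := Choice.copy (quat R) (can_type quat_tupleK).

Definition addq p q :=
  Quat (q0 p + q0 q) (q1 p + q1 q) (q2 p + q2 q) (q3 p + q3 q).
Definition oppq q := Quat (- q0 q) (- q1 q) (- q2 q) (- q3 q).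
Definition zeroq : quat R := Quat 0 0 0 0.
Definition oneq : quat R := Quat 1 0 0 0.
Definition mulq p q := Quat
  (q0 p * q0 q - q1 p * q1 q - q2 p * q2 q - q3 p * q3 q)
  (q0 p * q1 q + q1 p * q0 q + q2 p * q3 q - q3 p * q2 q)
  (q0 p * q2 q - q1 p * q3 q + q2 p * q0 q + q3 p * q1 q)
  (q0 p * q3 q + q1 p * q2 q - q2 p * q1 q + q3 p * q0 q).

Lemma addqA : associative addq.
Proof. by case=> ? ? ? ? [? ? ? ?] [? ? ? ?]; congr Quat => /=; ring. Qed.
Lemma addqC : commutative addq.
Proof. by case=> ? ? ? ? [? ? ? ?]; congr Quat => /=; ring. Qed.
Lemma add0q : left_id zeroq addq.
Proof. by case=> ? ? ? ?; congr Quat => /=; ring. Qed.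
Lemma addNq : left_inverse zeroq oppq addq.
Proof. by case=> ? ? ? ?; congr Quat => /=; ring. Qed.
HB.instance Definition _ :=
  GRing.isZmodule.Build (quat R) addqA addqC add0q addNq.

Lemma mulqA : associative mulq.
Proof. by case=> ? ? ? ? [? ? ? ?] [? ? ? ?]; congr Quat => /=; ring. Qed.
Lemma mul1q : left_id oneq mulq.
Proof. by case=> ? ? ? ?; congr Quat => /=; ring. Qed.
Lemma mulq1 : right_id oneq mulq.
Proof. by case=> ? ? ? ?; congr Quat => /=; ring. Qed.
Lemma mulqDl : left_distributive mulq addq.
Proof. by case=> ? ? ? ? [? ? ? ?] [? ? ? ?]; congr Quat => /=; ring. Qed.
Lemma mulqDr : right_distributive mulq addq.
Proof. by case=> ? ? ? ? [? ? ? ?] [? ? ? ?]; congr Quat => /=; ring. Qed.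
Lemma oneq_neq0 : oneq != zeroq.
Proof. by apply/eqP=> -[] /eqP; rewrite oner_eq0. Qed.
HB.instance Definition _ := GRing.Zmodule_isNzRing.Build (quat R)
  mulqA mul1q mulq1 mulqDl mulqDr oneq_neq0.

End QuatRing.

Section QuatRoots.
Variable R : realType.
Implicit Types (v w : quat R) (A : {poly quat R}).

Definition Sc w : R := q0 w.
Definition Vec w : quat R := Quat 0 (q1 w) (q2 w) (q3 w).
Definition qconj w : quat R := Quat (q0 w) (- q1 w) (- q2 w) (- q3 w).
Definition qnorm w : R :=
  Num.sqrt (q0 w ^+ 2 + q1 w ^+ 2 + q2 w ^+ 2 + q3 w ^+ 2).
Definition qdot w v : R :=
  q0 w * q0 v + q1 w * q1 v + q2 w * q2 v + q3 w * q3 v.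

(** [A.[w]] is \sum_m A`_m * w ^+ m, with the coefficients on the left of the
    powers, so [{poly quat R}] with [horner] and [root] models the right
    quaternionic polynomials. *)

Definition basic_coef A (m : nat) : quat R :=
  \sum_(d < size A) \sum_(r < size A | (d + r == m)%N) qconj A`_d * A`_r.

(** The coefficients of the basic polynomial are real quaternions, which
    justifies passing to complex coefficients through [Sc] below. *)
Lemma basic_coef_real A m : Vec (basic_coef A m) = 0.
Proof.
have VecD : {morph Vec : x y / x + y}.
  by case=> ? ? ? ? [? ? ? ?]; congr Quat => /=; rewrite addr0.
have conjD : {morph qconj : x y / x + y}.
  by case=> ? ? ? ? [? ? ? ?]; congr Quat => /=; rewrite opprD.
have conj0 : qconj 0 = 0 by congr Quat; rewrite /= oppr0.
have conjM x y : qconj (x * y) = qconj y * qconj x.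
  by case: x y => ? ? ? ? [? ? ? ?]; congr Quat => /=; ring.
have conjK x : qconj (qconj x) = x.
  by case: x => *; congr Quat => /=; rewrite opprK.
have : qconj (basic_coef A m) = basic_coef A m.
  rewrite /basic_coef (big_morph _ conjD conj0).
  under eq_bigr => d _ do rewrite (big_morph _ conjD conj0).
  rewrite (exchange_big_dep xpredT) //=; apply: eq_bigr => d _.
  by apply: eq_big => [r|r _]; rewrite ?conjM ?conjK // addnC.
case: (basic_coef A m) => a b c d [/eqP + /eqP + /eqP].
rewrite !eqNr => /eqP -> /eqP -> /eqP -> //.
Qed.

(** For [size A = n.+1] the degree bound below is [2 * n]. *)
Definition basic_poly A : {poly R[i]} :=
  \poly_(m < ((size A).-1).*2.+1) real_complex R (Sc (basic_coef A m)).

Definition same_sphere w : pred (quat R) :=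
  [pred v | (Sc v == Sc w) && (qnorm (Vec v) == qnorm (Vec w))].

Definition spherical_root A w : Prop :=
  [/\ root A w, 0 < qnorm (Vec w) & forall v, same_sphere w v -> root A v].

Definition isolated_root A w : Prop := root A w /\ ~ spherical_root A w.

Definition assoc_complex w : R[i] := Complex (Sc w) (qnorm (Vec w)).

(** A real root of the basic polynomial has even multiplicity, since on the
    real line this polynomial is x |-> |A.[x]|^2; hence [./2] is exact. *)
Definition root_mult A w : nat :=
  let k := mup (assoc_complex w) (basic_poly A) in
  if qnorm (Vec w) == 0 then k./2 else k.

Definition root_list A (ws : seq (quat R)) : Prop :=
  [/\ forall w, w \in ws -> root A w,
      forall w, isolated_root A w -> count_mem w ws = root_mult A w
    & forall w, spherical_root A w ->
        count (same_sphere w) ws = root_mult A w].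

End QuatRoots.

(* Main.v *)
Require Import Defs.
From mathcomp Require Import all_boot all_order all_algebra.
From mathcomp Require Import reals.
From mathcomp Require Import complex ring.

Set Implicit Arguments.
Unset Strict Implicit.
Unset Printing Implicit Defensive.

Import Order.TTheory GRing.Theory Num.Theory.
Local Open Scope ring_scope.

(** Both sides of the identity are, up to a factor -2, the ratio of the
    coefficients of degree 1 and 0 of the basic polynomial, which is a real
    polynomial F of degree at most 2n.

    From the definition, F`_0 = |A_0|^2 and F`_1 = 2 (A_1, A_0).
    On the other hand, attach to a quaternion w the real quadratic
    q_w = X^2 - 2 Sc(w) X + |w|^2, whose complex roots are z and its conjugate,
    z being the complex number associated with the sphere of w.  The product Q
    of the q_w over the n listed roots has degree 2n, so as soon as Q divides F
    the two are proportional.  Then F`_1 / F`_0 = Q`_1 / Q`_0, and this ratio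
    of coefficients is additive over products: it is the sum of
    - 2 Sc(w) / |w|^2 over the list.

    Divisibility is checked over the complex numbers, root by root: z must not
    occur in Q more often than in F.  This reduces to the fact that the number
    of listed quaternions on the sphere of w is the multiplicity of w.
    For spherical roots this is how the list is made; an isolated root is
    alone on its sphere ([roots_on_sphere]), because on a fixed sphere w^2 is a
    real affine function of w, so that the polynomial takes the form
    w |-> a w + b there ([horner_sphere]), and two distinct zeros force
    a = b = 0.  A real z is counted twice by each q_w, which
    compensates the halving in its multiplicity; a non-real z has the same
    multiplicity in F as its conjugate, F being real. *)

(** * Roots of polynomials over a field *)

(** Linear factors with repetition can be divided out one at a time, each
    lowering the multiplicity of its root in p by one. *)
Lemma prod_XsubC_dvdp (K : fieldType) (p : {poly K}) (rs : seq K) :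
    p != 0 -> (forall z, z \in rs -> (count_mem z rs <= mup z p)%N) ->
  \prod_(z <- rs) ('X - z%:P) %| p.
Proof.
elim: rs p => [|z rs IH] p p0 le_mup; first by rewrite big_nil dvd1p.
have : 'X - z%:P %| p.
  rewrite XsubC_dvd //; apply: leq_trans (le_mup z (mem_head _ _)).
  by rewrite /= eqxx.
move=> /dvdpP[q def_p]; move: p0 le_mup; rewrite def_p mulf_eq0.
rewrite polyXsubC_eq0 orbF => q0 le_mup.
rewrite big_cons mulrC dvdp_mul2r ?polyXsubC_eq0 //.
apply: IH => // y y_rs; have := le_mup y.
rewrite inE y_rs orbT => /(_ isT) /=.
by rewrite mupM ?polyXsubC_eq0 // (mup_XsubCX 1) addnC leq_add2r.
Qed.

(** The ratio p`_1 / p`_0 is the logarithmic derivative of p at 0, whence its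
    additivity over products. *)
Lemma coef1_div_coef0_prod (K : fieldType) (I : eqType) (r : seq I)
    (p : I -> {poly K}) :
    (forall i, i \in r -> (p i)`_0 != 0) ->
  (\prod_(i <- r) p i)`_1 / (\prod_(i <- r) p i)`_0
    = \sum_(i <- r) (p i)`_1 / (p i)`_0.
Proof.
move=> p0; suff [] : (\prod_(i <- r) p i)`_0 != 0 /\
    (\prod_(i <- r) p i)`_1 / (\prod_(i <- r) p i)`_0
    = \sum_(i <- r) (p i)`_1 / (p i)`_0 by [].
elim: r p0 => [|i r IH] p0.
  by rewrite !big_nil !coef1 /= mul0r oner_neq0.
have pi0 : (p i)`_0 != 0 by apply: p0; rewrite mem_head.
have [|r0 {}IH] := IH; first by move=> j jr; apply: p0; rewrite inE jr orbT.
rewrite !big_cons -IH !coef0M mulf_neq0 //; split=> //.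
rewrite coefM !big_ord_recl big_ord0 /= addr0 /bump /=.
by field; rewrite pi0 r0.
Qed.

(** Conjugating coefficients fixes p and maps 'X - z to 'X - conj z. *)
Lemma mup_conjc (R : realType) (p : {poly R[i]}) (z : R[i]) :
  map_poly (@conjc R) p = p -> p != 0 -> mup (conjc z) p = mup z p.
Proof.
move=> conjp p0.
have le_conj y : (mup y p <= mup (conjc y) p)%N.
  rewrite (mup_geq (conjc y) _ p0).
  have -> : 'X - (conjc y)%:P = map_poly (@conjc R) ('X - y%:P).
    by rewrite rmorphB /= map_polyX map_polyC.
  by rewrite -rmorphXn -[X in _ %| X]conjp dvdp_map -mup_geq.
apply/eqP; rewrite eqn_leq; apply/andP; split; last exact: le_conj.
by have := le_conj (conjc z); rewrite conjcK.
Qed.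

(** * Quaternions *)

Section Quaternions.
Variable R : realType.
Implicit Types (v w a b : quat R) (A : {poly quat R}).

Definition qsqnorm w : R := q0 w ^+ 2 + q1 w ^+ 2 + q2 w ^+ 2 + q3 w ^+ 2.

Lemma qsqnorm_ge0 w : 0 <= qsqnorm w.
Proof. by rewrite !addr_ge0 ?sqr_ge0. Qed.

Lemma qnorm_sqr w : qnorm w ^+ 2 = qsqnorm w.
Proof. exact: sqr_sqrtr (qsqnorm_ge0 w). Qed.

Lemma qsqnorm_eq0 w : (qsqnorm w == 0) = (w == 0).
Proof.
apply/eqP/eqP => [|->]; last by rewrite /qsqnorm /= expr0n /= !addr0.
case: w => x y z t /eqP; rewrite /qsqnorm /=.
rewrite !paddr_eq0 ?addr_ge0 ?sqr_ge0 // !sqrf_eq0.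
by case/andP=> /andP[/andP[/eqP-> /eqP->] /eqP->] /eqP->.
Qed.

Lemma qsqnormM v w : qsqnorm (v * w) = qsqnorm v * qsqnorm w.
Proof. by case: v w => ? ? ? ? [? ? ? ?]; rewrite /qsqnorm /=; ring. Qed.

Lemma mulq_eq0 v w : (v * w == 0) = (v == 0) || (w == 0).
Proof. by rewrite -!qsqnorm_eq0 qsqnormM mulf_eq0. Qed.

Lemma qsqnorm_ScVec w : qsqnorm w = Sc w ^+ 2 + qnorm (Vec w) ^+ 2.
Proof. by rewrite qnorm_sqr /qsqnorm /Sc /=; ring. Qed.

Lemma qnorm_ge0 w : 0 <= qnorm w.
Proof. exact: sqrtr_ge0. Qed.

Lemma qnorm_Vec_eq0 w : qnorm (Vec w) = 0 -> w = Quat (Sc w) 0 0 0.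
Proof.
move=> w0; have /eqP : qsqnorm (Vec w) = 0 by rewrite -qnorm_sqr w0 expr0n.
by rewrite qsqnorm_eq0; case: w {w0} => x y z t /eqP[-> -> ->].
Qed.

Lemma same_sphereE w v :
  same_sphere w v = (assoc_complex v == assoc_complex w).
Proof. by rewrite eq_complex. Qed.

Lemma same_sphere_refl w : same_sphere w w.
Proof. by rewrite same_sphereE. Qed.

Lemma quat_sqr_sphere w u : same_sphere w u ->
  u * u = Quat (Sc w *+ 2) 0 0 0 * u - Quat (qsqnorm w) 0 0 0.
Proof.
move=> /andP[/eqP eqSc /eqP eqVec].
have -> : qsqnorm w = qsqnorm u by rewrite !qsqnorm_ScVec eqSc eqVec.
rewrite -eqSc; case: u {eqSc eqVec} => x y z t.
by rewrite /qsqnorm; congr Quat => /=; ring.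
Qed.

(** Powers reduce by the quadratic relation satisfied on the sphere, whose
    coefficients depend only on the sphere. *)
Lemma horner_sphere A w :
  exists a b, forall u, same_sphere w u -> A.[u] = a * u + b.
Proof.
elim/poly_ind: A => [|A c [a [b Aab]]].
  by exists 0, 0 => u _; rewrite horner0 mul0r addr0.
exists (a * Quat (Sc w *+ 2) 0 0 0 + b), (c - a * Quat (qsqnorm w) 0 0 0) => u wu.
rewrite hornerMXaddC Aab // mulrDl -mulrA (quat_sqr_sphere wu).
by rewrite mulrBr !mulrDl mulrA -!addrA; congr (_ + _); rewrite addrC -!addrA.
Qed.

(** On the sphere the polynomial is u |-> a * u + b; its vanishing at two
    distinct points gives a * (v - w) = 0, hence a = 0 and then b = 0. *)
Lemma roots_on_sphere A w v : root A w -> root A v -> same_sphere w v ->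
  v != w -> spherical_root A w.
Proof.
move=> Aw Av wv neq_vw.
have [/eqP Aw0 /eqP Av0] := conj Aw Av.
split; first exact: Aw.
  rewrite lt_neqAle qnorm_ge0 andbT; apply: contraNneq neq_vw => /esym w0.
  case/andP: wv => /eqP eqSc /eqP eqVec.
  by rewrite (qnorm_Vec_eq0 w0) [v]qnorm_Vec_eq0 ?eqSc // eqVec.
have [a [b Aab]] := horner_sphere A w.
have ww := same_sphere_refl w.
have a0 : a = 0.
  have /eqP : a * (v - w) = 0.
    have /addIr eq_avw : a * v + b = a * w + b by rewrite -!Aab // Av0 Aw0.
    by rewrite mulrBr eq_avw subrr.
  by rewrite mulq_eq0 subr_eq0 (negPf neq_vw) orbF => /eqP.
have := Aab w ww; rewrite Aw0 a0 mul0r add0r => /esym b0 u wu.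
by rewrite /root (Aab u wu) a0 b0 mul0r addr0 eqxx.
Qed.

(** A listed root is either spherical, a case covered by the definition of
    the list, or isolated; then it is alone on its sphere, so that counting
    its sphere amounts to counting the root itself. *)
Lemma count_sphere A ws w : root_list A ws -> w \in ws ->
  count (same_sphere w) ws = root_mult A w.
Proof.
move=> [ws_root ws_isolated ws_spherical] w_ws.
apply/eqP/negPn/negP => /eqP ne_count.
have w_iso : isolated_root A w.
  by split; [exact: ws_root | move=> /ws_spherical].
case: ne_count; rewrite -(ws_isolated _ w_iso); apply: eq_in_count => v v_ws /=.
apply/idP/eqP => [wv | ->]; last exact: same_sphere_refl.
apply/eqP/negPn/negP => neq_vw; case: w_iso => _; apply.
exact: roots_on_sphere (ws_root _ w_ws) (ws_root _ v_ws) wv neq_vw.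
Qed.

(** * The basic polynomial *)

(** The basic polynomial before its real coefficients are made complex. *)
Definition real_basic_poly A : {poly R} :=
  \poly_(m < ((size A).-1).*2.+1) Sc (basic_coef A m).

Lemma basic_polyE A :
  basic_poly A = map_poly (real_complex R) (real_basic_poly A).
Proof.
apply/polyP => m; rewrite coef_map !coef_poly /=.
by case: ifP => _ //; rewrite rmorph0.
Qed.

Lemma real_basic_poly_coef0 A : (0 < size A)%N ->
  (real_basic_poly A)`_0 = qsqnorm A`_0.
Proof.
rewrite coef_poly /= /basic_coef; case: (size A) => // k _.
rewrite big_ord_recl big_mkcond big_ord_recl /= !big1 ?addr0; last first.
- by move=> i _.
- by move=> i _; rewrite big1.
by rewrite /Sc /qsqnorm /=; ring.
Qed.

Lemma real_basic_poly_coef1 A : (1 < size A)%N ->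
  (real_basic_poly A)`_1 = qdot A`_1 A`_0 *+ 2.
Proof.
rewrite coef_poly /basic_coef; case: (size A) => [|[|k]] // _.
rewrite !big_ord_recl !(big_mkcond (fun r => _ == _)) /= !big_ord_recl /= !big1.
- by rewrite /Sc /qdot /bump /=; ring.
- by move=> i _; rewrite big1.
- by move=> i _.
Qed.

Lemma mup_basic_poly_conj A z : real_basic_poly A != 0 ->
  mup (conjc z) (basic_poly A) = mup z (basic_poly A).
Proof.
move=> F0; rewrite basic_polyE; apply: mup_conjc; last by rewrite map_poly_eq0.
by rewrite -map_poly_comp; apply: eq_map_poly => x /=; rewrite oppr0.
Qed.

(** * The real polynomial of a list of roots *)

Lemma assoc_complex_conj v w : assoc_complex w = conjc (assoc_complex v) ->
  qnorm (Vec w) = 0.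
Proof.
move=> [_ eqVec]; apply/eqP; rewrite eq_le qnorm_ge0 andbT.
by rewrite eqVec oppr_le0 qnorm_ge0.
Qed.

(** Each quaternion contributes both conjugates, hence contributes a real
    number twice: these are the roots of the quadratics multiplied below. *)
Definition complex_roots (ws : seq (quat R)) : seq R[i] :=
  map (@assoc_complex R) ws ++ map (@conjc R \o @assoc_complex R) ws.

Lemma count_complex_roots_conj ws z :
  count_mem (conjc z) (complex_roots ws) = count_mem z (complex_roots ws).
Proof.
rewrite !count_cat !count_map addnC; congr addn; apply: eq_count => w.
  exact: (can_eq (@conjcK R)).
exact/esym/(inv_eq (@conjcK R)).
Qed.

(** By conjugation z may be taken to come from the first half of the list,
    where it occurs once for each listed quaternion on its sphere, that is,
    [root_mult] times. If z is not real, it is absent from the second half,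
    whose members have nonpositive imaginary part; if z is real, it occurs
    again [root_mult] times, which is then half of its multiplicity in the
    basic polynomial, rounded down. *)
Lemma count_complex_roots A ws z : real_basic_poly A != 0 -> root_list A ws ->
    z \in complex_roots ws ->
  (count_mem z (complex_roots ws) <= mup z (basic_poly A))%N.
Proof.
move=> F0 Aws z_ws.
suff {z z_ws} le_assoc w : w \in ws ->
    (count_mem (assoc_complex w) (complex_roots ws)
       <= mup (assoc_complex w) (basic_poly A))%N.
  move: z_ws; rewrite mem_cat => /orP[] /mapP[w w_ws ->]; first exact: le_assoc.
  rewrite [comp _ _ _]/comp (mup_basic_poly_conj _ F0).
  by rewrite count_complex_roots_conj le_assoc.
move=> w_ws; rewrite count_cat !count_map.
have count_assoc :
    count (preim (@assoc_complex R) (pred1 (assoc_complex w))) ws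
      = root_mult A w.
  by rewrite -(count_sphere Aws w_ws); apply: eq_count => v; rewrite same_sphereE.
rewrite count_assoc /root_mult; case: eqP => [w_real | w_nonreal].
  have conj_w : assoc_complex w = conjc (assoc_complex w).
    by rewrite /assoc_complex w_real /= oppr0.
  have -> : count (preim (@conjc R \o @assoc_complex R) (pred1 (assoc_complex w))) ws
      = root_mult A w.
    rewrite -count_assoc; apply: eq_count => v.
    have := can_eq (@conjcK R) (assoc_complex v) (assoc_complex w).
    by rewrite -conj_w; apply.
  rewrite /root_mult w_real eqxx addnn.
  by rewrite -{2}[mup _ _]odd_double_half leq_addl.
rewrite (_ : count _ ws = 0)%N ?addn0 //; apply/eqP; rewrite -leqn0 leqNgt -has_count.
by apply/hasPn => v _ /=; apply/eqP => /esym/assoc_complex_conj.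
Qed.

(** The real quadratic satisfied by every quaternion on the sphere of w, see
    [quat_sqr_sphere]. *)
Definition sphere_poly w : {poly R} :=
  'X^2 - (Sc w *+ 2) *: 'X + (qsqnorm w)%:P.

Lemma sphere_poly_coef0 w : (sphere_poly w)`_0 = qsqnorm w.
Proof. by rewrite !coefE /= mulr0 subr0 add0r. Qed.

Lemma sphere_poly_coef1 w : (sphere_poly w)`_1 = - (Sc w *+ 2).
Proof. by rewrite !coefE /= mulr1 add0r addr0. Qed.

Lemma sphere_poly_split w : map_poly (real_complex R) (sphere_poly w)
  = ('X - (assoc_complex w)%:P) * ('X - (conjc (assoc_complex w))%:P).
Proof.
rewrite rmorphD rmorphB /= map_polyXn map_polyZ map_polyX map_polyC /=.
set z := assoc_complex w.
have -> : real_complex R (Sc w *+ 2) = z + conjc z.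
  by apply/eqP; rewrite eq_complex /= subrr mulr2n !eqxx.
have -> : real_complex R (qsqnorm w) = z * conjc z.
  apply/eqP; rewrite eq_complex qsqnorm_ScVec /=; apply/andP.
  by split; apply/eqP; ring.
by rewrite -mul_polyC rmorphD rmorphM /=; ring.
Qed.

Lemma prod_sphere_poly_split ws :
  map_poly (real_complex R) (\prod_(w <- ws) sphere_poly w)
    = \prod_(z <- complex_roots ws) ('X - z%:P).
Proof.
rewrite rmorph_prod /= big_cat !big_map /= -big_split /=.
by apply: eq_bigr => w _; apply: sphere_poly_split.
Qed.

(** Comparing multiplicities of complex roots, the product divides the basic
    polynomial; its degree is already the largest possible for the latter, so
    the quotient is constant. *)
Lemma real_basic_poly_prod A (ws : seq (quat R)) : size A = (size ws).+1 ->
    real_basic_poly A != 0 -> root_list A ws ->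
  exists c, real_basic_poly A = c *: \prod_(w <- ws) sphere_poly w.
Proof.
move=> szA F0 Aws.
have szQ : size (\prod_(w <- ws) sphere_poly w) = (size ws).*2.+1.
  rewrite -(size_map_poly (real_complex R)) prod_sphere_poly_split.
  by rewrite size_prod_XsubC size_cat !size_map addnn.
have /dvdpP[q def_F] : \prod_(w <- ws) sphere_poly w %| real_basic_poly A.
  rewrite -(dvdp_map (real_complex R)) prod_sphere_poly_split -basic_polyE.
  apply: prod_XsubC_dvdp; first by rewrite basic_polyE map_poly_eq0.
  by move=> z; apply: count_complex_roots.
have szq : (size q <= 1)%N.
  have : (size (real_basic_poly A) <= (size ws).*2.+1)%N.
    by apply: leq_trans (size_poly _ _) _; rewrite szA.
  move: F0; rewrite def_F mulf_eq0 negb_or => /andP[q0 Q0].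
  by rewrite size_mul // szQ addnS /= -add1n leq_add2r.
by exists q`_0; rewrite def_F {1}(size1_polyC szq) mul_polyC.
Qed.

End Quaternions.

Theorem theorem5 (R : realType) (n : nat) (A : {poly quat R})
    (ws : n.-tuple (quat R)) :
  (1 <= n)%N ->
  size A = n.+1 ->
  A`_0 != 0 ->
  root_list A ws ->
  \sum_(m < n) Sc (tnth ws m) / qnorm (tnth ws m) ^+ 2
    = - (qdot A`_1 A`_0 / qnorm A`_0 ^+ 2).
Proof.
move=> n_gt0 szA A0 Aws.
have F0 : (real_basic_poly A)`_0 = qsqnorm A`_0.
  by rewrite real_basic_poly_coef0 ?szA.
have F0_neq0 : (real_basic_poly A)`_0 != 0 by rewrite F0 qsqnorm_eq0.
have [c def_F] : exists c, real_basic_poly A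
    = c *: \prod_(w <- ws) sphere_poly w.
  apply: real_basic_poly_prod; rewrite ?size_tuple //.
  by apply: contraNneq F0_neq0 => ->; rewrite coef0.
have c0 : c != 0.
  by apply: contraNneq F0_neq0 => c0; rewrite def_F c0 scale0r coef0.
have w0 w : w \in (ws : seq _) -> qsqnorm w != 0.
  move=> w_ws; rewrite qsqnorm_eq0.
  have [/(_ _ w_ws) Aw _ _] := Aws.
  apply: contraNneq A0 => w0.
  by move: Aw; rewrite w0 /root horner_coef0.
have ratioF : (real_basic_poly A)`_1 / (real_basic_poly A)`_0
    = \sum_(w <- ws) (sphere_poly w)`_1 / (sphere_poly w)`_0.
  rewrite -coef1_div_coef0_prod => [|w w_ws]; last by rewrite sphere_poly_coef0 w0.
  by rewrite def_F !coefZ -mulf_div divff // mul1r.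
move: ratioF; rewrite F0 real_basic_poly_coef1 ?szA //.
rewrite -(big_tuple _ _ ws xpredT (fun w => Sc w / qnorm w ^+ 2)) qnorm_sqr.
have -> : \sum_(w <- ws) (sphere_poly w)`_1 / (sphere_poly w)`_0
    = - (\sum_(w <- ws) Sc w / qnorm w ^+ 2) *+ 2.
  rewrite -sumrN -sumrMnl; apply: eq_bigr => w _.
  by rewrite sphere_poly_coef0 sphere_poly_coef1 qnorm_sqr mulNr mulrnAl mulNrn.
by rewrite mulrnAl => /eqP; rewrite eqrMn2r //= => /eqP ->; rewrite opprK.
Qed.
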